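(* Let $L,K\in\mathbb N$, $\gamma\in(0,1)$, let $\infty=y_0>y_1>\dots>y_{K-1}>y_K=0$, and let $j\in\{1,\dots,K\}$. Suppose that the approximation $G_L$ of $G$ satisfies the selective refinement assumption (stated in the context), i.e. $G_L^{y_j}$ and $G_L^{y_{j-1}}$ satisfy it at the values $y=y_j$ and $y=y_{j-1}$, and that $y_{j-1}-y_j\ge 2\gamma^L$. Then $$F_j^L=\{\omega: G_L^{y_j}(\omega)\le y_j\}\subset\{\omega: G_L^{y_{j-1}}(\omega)\le y_{j-1}\}=F_{j-1}^L .$$
   Context: $(\Omega,\Sigma,\mathbb P)$ is a probability space and $G:\Omega\to\mathbb R$ is a random variable having a probability density with respect to Lebesgue measure. $\mathcal C[\cdot]$ denotes the computational cost of evaluating a random variable. Selective refinement assumption: the cdf of $G$ is Lipschitz continuous, i.e. there is $c_{\mathrm{Lip}}>0$ with $|\mathbb P(G\le y)-\mathbb P(G\le x)|\le c_{\mathrm{Lip}}|y-x|$ for all $x,y\in\mathbb R$. Let $\gamma\in(0,1)$ and $q\ge 0$. For fixed $y\in\mathbb R$ and for all $\ell\in\mathbb N$ there is a random variable $G_\ell^y:\Omega\to\mathbb R$ (an approximation of $G$ that may depend on $y$) such that $$|G(\omega)-G_\ell^y(\omega)|\le\max\big(\gamma^\ell,\,|G_\ell^y(\omega)-y|\big)\quad\mathbb P\text{-a.s. in }\omega,$$ and there is a constant $c_0>0$ such that $\mathbb E[\mathcal C[G_\ell^y]]\le c_0(1+\gamma^{(1-q)\ell})$. For $y_0=\infty$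 the convention is $F_0^L=\Omega$.
   Formalization: The inclusion of F_j^L in F_{j-1}^L is stated for P-almost every ω rather than for every ω, since the error bounds are assumed only almost surely and the inclusion can fail on a null set. *)

(* Defs.v *)
From HB Require Import structures.
From mathcomp Require Import all_boot all_order all_algebra.
From mathcomp Require Import all_classical all_reals all_analysis.

Set Implicit Arguments.
Unset Strict Implicit.
Unset Printing Implicit Defensive.

Import Order.TTheory GRing.Theory Num.Theory.
Import numFieldNormedType.Exports.

Local Open Scope classical_set_scope.
Local Open Scope ring_scope.

Definition has_density d (T : measurableType d) (R : realType)
    (P : probability T R) (X : {RV P >-> R}) : Prop :=
  exists f : R -> R,
    [/\ measurable_fun setT f, (forall x, 0 <= f x)
      & forall A : set R, measurable A ->
          distribution P X A = (\int[lebesgue_measure]_(x in A) (f x)%:E)%E].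

Definition lipschitz_cdf d (T : measurableType d) (R : realType)
    (P : probability T R) (X : {RV P >-> R}) : Prop :=
  exists2 cLip : R, 0 < cLip &
    forall x y : R, `|fine (cdf X y) - fine (cdf X x)| <= cLip * `|y - x|.

(* The computational cost is an abstract functional: [cost X w] is the cost of
   evaluating X at the outcome w, so that [cost X] is itself random. *)
Definition cost_functional d (T : measurableType d) (R : realType)
    (P : probability T R) : Type := {RV P >-> R} -> {RV P >-> R}.

(* The assumption at one fixed value y; [Gy l] is the level-l approximation
   of G made for this y. *)
Record selective_refinement d (T : measurableType d) (R : realType)
    (P : probability T R) (cost : cost_functional P) (gamma q : R)
    (G : {RV P >-> R}) (y : R) (Gy : nat -> {RV P >-> R}) : Prop := {
  sr_lipschitz : lipschitz_cdf G ;
  sr_error : forall l : nat,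
    {ae P, forall w, `|G w - Gy l w| <= Num.max (gamma ^+ l) `|Gy l w - y|} ;
  sr_cost : exists2 c0 : R, 0 < c0 &
    forall l : nat,
      ('E_P[cost (Gy l)] <= (c0 * (1 + gamma `^ ((1 - q) * l%:R)))%:E)%E }.

(* {w | G_L^y(w) <= y} for an extended threshold y.  There is no approximation
   G_L^y at y = +oo: by convention the set is then the whole sample space. *)
Definition failure_set d (T : measurableType d) (R : realType)
    (P : probability T R) (Gapp : R -> nat -> {RV P >-> R}) (L : nat)
    (y : \bar R) : set T :=
  match y with
  | r%:E%E => [set w | Gapp r L w <= r]
  | +oo%E => setT
  | -oo%E => set0
  end.

(* Main.v *)
(* With e = gamma^L: if G_L^a <= a then the error bound gives G <= a + e, while
   G_L^b > b gives G > b - e, which is impossible when b - a >= 2 e. *)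
Require Import Defs.
From HB Require Import structures.
From mathcomp Require Import all_boot all_order all_algebra.
From mathcomp Require Import all_classical all_reals all_analysis.
From mathcomp Require Import lra.

Set Implicit Arguments.
Unset Strict Implicit.
Unset Printing Implicit Defensive.

Import Order.TTheory GRing.Theory Num.Theory.
Import numFieldNormedType.Exports.

Local Open Scope classical_set_scope.
Local Open Scope ring_scope.

(** The error bound either is [e] or equals the distance from the approximation to its threshold, so
    [G] can cross that threshold by at most [e]. A gap of [2 * e] thus separates the two cases.
    [threshold_transfer] is this argument at one outcome; the inclusion holds almost surely because
    both error bounds do. *)

Lemma threshold_transfer (R : realDomainType) (e a b g ga gb : R) :
  0 < e -> 2 * e <= b - a ->
  `|g - ga| <= Num.max e `|ga - a| -> `|g - gb| <= Num.max e `|gb - b| ->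
  ga <= a -> gb <= b.
Proof.
move=> e0 gap Ha Hb gaa; rewrite leNgt; apply/negP => bgb.
have g_le : g <= a + e.
  move: Ha; rewrite ler_norml le_max ler0_norm ?subr_le0//.
  by move=> /andP[_ /orP[]]; lra.
(* Strict in both branches of the max: [b < gb] gives [b - e < g] in the first; in the second
   [b <= g], and [0 < e] makes [b] exceed [a + e]. *)
have g_gt : a + e < g.
  move: Hb; rewrite distrC ler_norml le_max gtr0_norm ?subr_gt0//.
  by move=> /andP[_ /orP[]]; lra.
lra.
Qed.

Theorem lemma3p1 (d : measure_display) (T : measurableType d) (R : realType)
    (P : probability T R) (G : {RV P >-> R}) (G_density : has_density G)
    (cost : cost_functional P)
    (cost_ge0 : forall (X : {RV P >-> R}) (w : T), 0 <= cost X w)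
    (L K : nat) (gamma q : R)
    (gamma_gt0 : 0 < gamma) (gamma_lt1 : gamma < 1) (q_ge0 : 0 <= q)
    (y : nat -> \bar R)
    (y_first : y 0%N = +oo%E) (y_last : y K = 0%E)
    (y_decr : forall i : nat, (i < K)%N -> (y i.+1 < y i)%E)
    (j : nat) (j_ge1 : (1 <= j)%N) (j_leK : (j <= K)%N)
    (Gapp : R -> nat -> {RV P >-> R})
    (Gapp_j : forall r : R, y j = r%:E ->
       selective_refinement cost gamma q G r (Gapp r))
    (Gapp_j1 : forall r : R, y j.-1 = r%:E ->
       selective_refinement cost gamma q G r (Gapp r))
    (y_gap : ((2 * gamma ^+ L)%:E <= y j.-1 - y j)%E) :
  {ae P, forall w : T,
     w \in failure_set Gapp L (y j) -> w \in failure_set Gapp L (y j.-1)}.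
Proof.
case yj1 : (y j.-1) y_gap => [b| |] y_gap.
(* [y j = +oo] would make the gap [-oo]; for [y j = -oo] the smaller set is empty. *)
- case yj : (y j) y_gap => [a| |] y_gap //; last first.
    by apply: aeW => w; rewrite in_set0.
  have gap : 2 * gamma ^+ L <= b - a by rewrite -lee_fin.
  have gL : 0 < gamma ^+ L by exact: exprn_gt0.
  (* Discards the union of the two exceptional null sets. *)
  apply: filterS2 (sr_error (Gapp_j _ yj) L) (sr_error (Gapp_j1 _ yj1) L).
  move=> w Ha Hb; rewrite !inE /=.
  exact: threshold_transfer gL gap Ha Hb.
- by apply: aeW => w _; rewrite in_setT.
(* With [y j.-1 = -oo] the difference is [-oo] for every [y j], even [-oo], by the convention for
   adding opposite infinities. *)
- by case: (y j) y_gap.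
Qed.
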